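(* Fix a positive integer $c$ and families $\mathcal{P}_1,\dots,\mathcal{P}_c$ of permutations. Suppose there are constants $a_1,\dots,a_c$ such that for every $1\le i\le c$ and every $P_i\in\mathcal{P}_i$ we have $L(P_i)\le |P_i|^{a_i}$, and let $a=\max_{1\le i\le c}a_i$. Then, for sufficiently large $k$, every $k$-permutation $\pi\in B_{\{\mathcal{P}_1,\dots,\mathcal{P}_c\}}$ satisfies $$L(\pi)=O\!\left(k^{4a+16c^2+64ac^2\ln c}\right).$$ In particular, the Stanley–Wilf limit of a $k$-permutation in $B_{\{\mathcal{P}_1,\dots,\mathcal{P}_c\}}$ is polynomial in $k$.
   Context: An $n$-permutation $\sigma$ contains a $k$-permutation $\pi$ if $\sigma$ has a subsequence of length $k$ order-isomorphic to $\pi$; otherwise $\sigma$ avoids $\pi$. $\mathrm{Av}_n(\pi)$ is the set of $n$-permutations avoiding $\pi$, and the Stanley–Wilf limit is $L(\pi)=\lim_{n\to\infty}|\mathrm{Av}_n(\pi)|^{1/n}$ (which exists and is finite). For a permutation $\sigma$ of length $m$ and nonempty permutations $P_1,\dots,P_m$, the inflation $\sigma[P_1,\dots,P_m]$ is the permutation of length $|P_1|+\dots+|P_m|$ obtained by replacing each entry $\sigma(i)$ by an interval of consecutive values order-isomorphic to $P_i$, the intervals being arranged order-isomorphically to $\sigma$. A permutation is $c$-blockable if it equals $\sigma[P_1,\dots,P_c]$ for some $c$-permutation $\sigma$ and permutations $P_1,\dots,P_c$. For families $\mathcal{P}_1,\dots,\mathcal{P}_c$, $B_{\{\mathcal{P}_1,\dots,\mathcal{P}_c\}}$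 is the family of all $\sigma[P_1,\dots,P_c]$ with $\sigma$ any $c$-permutation and $P_i\in\mathcal{P}_i$. *)

(* Defs.v *)
From HB Require Import structures.
From mathcomp Require Import all_boot all_order all_algebra all_fingroup.
From mathcomp Require Import all_classical all_reals all_analysis.
Set Implicit Arguments.
Unset Strict Implicit.
Unset Printing Implicit Defensive.
Import Order.TTheory GRing.Theory Num.Theory.
Import numFieldNormedType.Exports.
Local Open Scope classical_set_scope.
Local Open Scope ring_scope.

(* 'S_n is the type of permutations of {0, ..., n-1}. A pattern is a
   permutation of unspecified length, so that patterns of different lengths
   can be members of the same set. *)
Definition pattern := {n : nat & 'S_n}.

Definition plen (p : pattern) : nat := tag p.

Definition pperm (p : pattern) : 'S_(plen p) := tagged p.

(* f lists the positions of an occurrence of p in s. *)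
Definition contains (n : nat) (s : 'S_n) (p : pattern) : bool :=
  [exists f : {ffun 'I_(plen p) -> 'I_n},
     [forall i : 'I_(plen p), forall j : 'I_(plen p), (i < j)%N ==> (f i < f j)%N] &&
     [forall i : 'I_(plen p), forall j : 'I_(plen p),
        (s (f i) < s (f j))%N == (pperm p i < pperm p j)%N]].

Definition Av (n : nat) (p : pattern) : {set 'S_n} :=
  [set s : 'S_n | ~~ contains s p]%SET.

Definition SW_limit (R : realType) (p : pattern) : R :=
  lim ((fun n : nat => (#|Av n p|%:R : R) `^ (n%:R^-1)) @ \oo).

Section Inflation.
Variables (c : nat) (s : 'S_c) (P : 'I_c -> pattern).

(* Least value taken on the i-th block: the blocks below it are those whose
   entry in s is smaller. *)
Definition block_start (i : 'I_c) : nat :=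
  (\sum_(j < c | (s j < s i)%N) plen (P j))%N.

(* A position x is in block sig1 x, at offset sig2 x; the blocks are laid out
   from left to right (tagnat.rect). *)
Definition inflation_val (x : 'I_(\sum_(i < c) plen (P i))) : nat :=
  (block_start (tagnat.sig1 x) + pperm (P (tagnat.sig1 x)) (tagnat.sig2 x))%N.

Lemma inflation_val_lt x : (inflation_val x < \sum_(i < c) plen (P i))%N.
Proof.
rewrite /inflation_val /block_start; set i := tagnat.sig1 x.
rewrite [ltnRHS](bigID (fun j : 'I_c => (s j < s i)%N)) /= ltn_add2l.
by rewrite (bigD1 i) ?ltnn //= ltn_addr.
Qed.

Lemma block_start_lt (i j : 'I_c) : (s i < s j)%N ->
  (block_start i + plen (P i) <= block_start j)%N.
Proof.
move=> lij; rewrite /block_start.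
rewrite [leqRHS](bigID (fun k : 'I_c => (s k < s i)%N)) /= leq_add //.
  rewrite [leqRHS](eq_bigl (fun k : 'I_c => (s k < s i)%N)) // => k /=.
  by case: (ltnP (s k) (s i)); rewrite ?andbF // => /ltn_trans ->.
by rewrite (bigD1 i) ?ltnn ?lij //= leq_addr.
Qed.

Definition inflation_fun (x : 'I_(\sum_(i < c) plen (P i))) :
  'I_(\sum_(i < c) plen (P i)) := Ordinal (inflation_val_lt x).

Lemma inflation_fun_inj : injective inflation_fun.
Proof.
move=> x y /(congr1 val) /=; rewrite /inflation_val => exy.
apply: (can_inj (@tagnat.sigK _ _)); rewrite !tagnat.sigE12.
move: (tagnat.sig1 x) (tagnat.sig2 x) (tagnat.sig1 y) (tagnat.sig2 y) exy.
move=> i u j v exy.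
have block_lt k l (w : 'I_(plen (P k))) (z : nat) : (s k < s l)%N ->
    (block_start k + pperm (P k) w < block_start l + z)%N.
  move=> /block_start_lt kl; rewrite ltn_addr //.
  by apply: leq_trans kl; rewrite ltn_add2l.
have [lij|lji|/val_inj/perm_inj eij] := ltngtP (s i) (s j).
- by have := block_lt _ _ u (pperm (P j) v) lij; rewrite exy ltnn.
- by have := block_lt _ _ v (pperm (P i) u) lji; rewrite exy ltnn.
- by case: _ / eij v exy => v /addnI /val_inj /perm_inj ->.
Qed.

Definition inflation : pattern :=
  Tagged (fun n => 'S_n) (perm inflation_fun_inj).

End Inflation.

(* Only nonempty patterns are used as blocks. *)
Definition blockable_family (c : nat) (F : 'I_c -> set pattern) : set pattern :=
  [set q | exists (s : 'S_c) (P : 'I_c -> pattern),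
     (forall i, F i (P i) /\ (0 < plen (P i))%N) /\ q = inflation s P].

(* Main.v *)
(* Proof. Work with 0-1 matrices: a class of matrices avoiding p has linear
   constant C if its n x n members have at most C n ones.
   (1) If |Av_n(p)| <= l^n for all n, then the linear constant of p is O(l^8):
   u rows having 2u ones each in t columns contain at least u^u systems of
   distinct columns, hence at least u^u / binom(t, u) permutation matrices on a
   fixed set of columns, so that avoidance of p forces u^2 <= 4 t l. This bounds
   the number of wide and tall blocks in the Marcus-Tardos recursion, and the
   number of ones of the other blocks, with t polynomial in l.
   (2) If each P_i has linear constant C, then sigma[P_1, ..., P_c] has linear
   constant O(C^(2c+4)): among c t t^c rows with c(C+1) ones in t columns, c t
   can be cut at the same places into c intervals carrying C+1 ones each, and t
   of these rows contain P_i in a prescribed interval. So there are few wide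
   blocks in the Marcus-Tardos recursion with t = 4 (c(C+1))^2.
   (3) A linear constant C gives Stanley-Wilf limit at most 16 C^2: contract a
   permutation matrix of size C 2^j to size 2^j; there are 16^(C 2^j)
   contractions, and by the AM-GM inequality each has at most (C^2)^(C 2^j)
   preimages.
   Hence L(pi) = O(l^(32c+64)) with l of order k^a, and for c >= 2 one has
   32c + 64 <= 4 + 64 c^2 ln c because ln c >= 1/2. For c = 1 there is
   nothing to do, as pi = P_1. *)
Require Import Defs.
From HB Require Import structures.
From mathcomp Require Import all_boot all_order all_algebra all_fingroup.
From mathcomp Require Import all_classical all_reals all_analysis.
From mathcomp Require Import zify ring lra.
Set Implicit Arguments.
Unset Strict Implicit.
Unset Printing Implicit Defensive.
Import Order.TTheory GRing.Theory Num.Theory.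
Import numFieldNormedType.Exports.
Local Open Scope classical_set_scope.
Local Open Scope ring_scope.

(** * Matrices and the Marcus-Tardos recursion *)

Section Matrices.
Local Open Scope nat_scope.

(** Columns are indexed by value, so that transposing swaps [r] and [q] and inverts the pattern. *)
Definition occurrence (A : rel nat) (p : pattern) (r q : 'I_(plen p) -> nat) :=
  [/\ forall x y : 'I_(plen p), x < y -> r x < r y,
      forall x y : 'I_(plen p), x < y -> q x < q y &
      forall x, A (r x) (q (pperm p x))].

Definition mcontains A p := exists r q, @occurrence A p r q.

Definition inv_pattern (p : pattern) : pattern :=
  Tagged (fun n => 'S_n) (pperm p)^-1%g.

Definition mxT (A : rel nat) : rel nat := fun i j => A j i.

Definition ones (A : rel nat) (m n : nat) : nat :=
  \sum_(i < m) \sum_(j < n) nat_of_bool (A i j).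

(** Avoidance is asked of the whole infinite relation; a finite matrix is read as its extension by
    zeros. *)
Definition ex_le (C : nat) (p : pattern) : Prop :=
  forall (A : rel nat) n, ~ mcontains A p -> ones A n n <= C * n.

Definition contr (t u : nat) (A : rel nat) : rel nat := fun i j =>
  [exists x : 'I_t, [exists y : 'I_u, A (i * t + x) (j * u + y)]].

Lemma occurrence_sub (A B : rel nat) p r q (rho kap : nat -> nat) :
  {homo rho : i j / i < j} -> {homo kap : i j / i < j} ->
  (forall i j, B i j -> A (rho i) (kap j)) ->
  @occurrence B p r q -> @occurrence A p (rho \o r) (kap \o q).
Proof.
move=> rhoP kapP BA [rP qP Brq].
by split => [x y /rP /rhoP //|x y /qP /kapP //|x]; apply/BA/Brq.
Qed.

Lemma mcontains_sub (A B : rel nat) p (rho kap : nat -> nat) :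
  {homo rho : i j / i < j} -> {homo kap : i j / i < j} ->
  (forall i j, B i j -> A (rho i) (kap j)) ->
  mcontains B p -> mcontains A p.
Proof.
move=> rhoP kapP BA [r [q rq]].
by exists (rho \o r), (kap \o q); apply: occurrence_sub rq.
Qed.

Lemma occurrenceT A p r q :
  @occurrence A p r q -> @occurrence (mxT A) (inv_pattern p) q r.
Proof.
move=> [rP qP Arq]; split=> // x; rewrite /mxT.
by have := Arq ((pperm p)^-1%g x); rewrite permKV.
Qed.

Lemma mcontainsT A p : mcontains A p -> mcontains (mxT A) (inv_pattern p).
Proof. by move=> [r [q /occurrenceT rq]]; exists q, r. Qed.

Lemma inv_patternK p : inv_pattern (inv_pattern p) = p.
Proof. by case: p => n s; rewrite /inv_pattern /pperm /= invgK. Qed.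

Lemma mcontainsT_inv A p : mcontains (mxT A) (inv_pattern p) -> mcontains A p.
Proof. by move=> /mcontainsT; rewrite inv_patternK. Qed.

(** Pick any one inside each block used: entries in different block rows or block columns keep their
    order whatever the choice. *)
Lemma mcontains_contr t u A p : mcontains (contr t u A) p -> mcontains A p.
Proof.
move=> [r [q [rP qP Arq]]].
have /choice[f fP] : forall x, exists z : 'I_t * 'I_u,
    A (r x * t + z.1) (q (pperm p x) * u + z.2).
  by move=> x; have /existsP[a /existsP[b ab]] := Arq x; exists (a, b).
exists (fun x => r x * t + (f x).1).
exists (fun y => q y * u + (f ((pperm p)^-1%g y)).2).
split=> [x y /rP rxy|x y /qP qxy|x]; last by rewrite permK.
- by have := ltn_ord (f x).1; nia.
- by have := ltn_ord (f ((pperm p)^-1%g x)).2; nia.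
Qed.

Lemma ones_mxT A m n : ones (mxT A) m n = ones A n m.
Proof. exact: exchange_big. Qed.

Lemma ex_le_inv C p : ex_le C p -> ex_le C (inv_pattern p).
Proof.
move=> pC A n nA; rewrite -ones_mxT; apply: pC => cA; apply: nA.
by have := mcontainsT cA.
Qed.

Lemma sum_bool_iota (X : pred nat) t :
  \sum_(j < t) nat_of_bool (X j) = size [seq j <- iota 0 t | X j].
Proof.
rewrite size_filter -sum1_count [RHS]big_mkcond /=.
by rewrite -(big_mkord xpredT (fun i => nat_of_bool (X i))) /index_iota subn0.
Qed.

Lemma increasing_enum (X : pred nat) m :
  let k := \sum_(i < m) nat_of_bool (X i) in
  exists rho : nat -> nat, [/\ {homo rho : i j / i < j},
    forall i, i < k -> (rho i < m) && X (rho i) &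
    forall F : nat -> nat, \sum_(i < m | X i) F i = \sum_(i < k) F (rho i)].
Proof.
move=> k; pose s := [seq i <- iota 0 m | X i].
have size_s : size s = k by rewrite /k sum_bool_iota.
have s_sorted : sorted ltn s.
  by apply: sorted_filter (iota_ltn_sorted _ _) => ? ? ?; apply: ltn_trans.
have sP i : i < size s -> (nth 0 s i < m) && X (nth 0 s i).
  by move=> /(mem_nth 0); rewrite mem_filter mem_iota /= add0n andbC.
(* The tail [m + i] keeps [rho] strictly increasing on all of [nat], as transporting occurrences
   requires. *)
exists (fun i => if i < size s then nth 0 s i else m + i); split=> [i j ij|i ik|F].
- case: ifPn => [is_|]; case: ifPn => [js|]; last lia.
  + exact: (sorted_ltn_nth ltn_trans).
  + by have /andP[] := sP _ is_; lia.
  + lia.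
- by rewrite size_s ik; apply: sP; rewrite size_s.
- rewrite -(big_mkord X F) -big_filter /index_iota subn0 -/s.
  rewrite (big_nth 0) big_mkord size_s; apply: eq_bigr => i _.
  by rewrite ltn_ord.
Qed.

Lemma sum_blocks (F : nat -> nat) N t :
  \sum_(i < N * t) F i = \sum_(a < N) \sum_(x < t) F (a * t + x).
Proof.
rewrite -(big_mkord xpredT F) big_nat_mul big_mkord.
apply: eq_bigr => a _; rewrite -{1}[(a * t)]addn0 mulSn addnC big_addn.
by rewrite addnK big_mkord; apply: eq_bigr => x _; rewrite addnC.
Qed.

Lemma ones_mono A m m' n n' : m <= m' -> n <= n' -> ones A m n <= ones A m' n'.
Proof.
move=> mm nn; rewrite /ones.
apply: (@leq_trans (\sum_(i < m) \sum_(j < n') nat_of_bool (A i j))).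
  apply: leq_sum => i _.
  rewrite -!(big_mkord xpredT (fun j => nat_of_bool (A i j))).
  by rewrite (big_cat_nat _ nn) //= leq_addr.
rewrite -!(big_mkord xpredT (fun i => \sum_(j < n') nat_of_bool (A i j))).
by rewrite (big_cat_nat _ mm) //= leq_addr.
Qed.

Lemma ones_le A m n : ones A m n <= m * n.
Proof.
rewrite -[X in X * _]card_ord -sum_nat_const; apply: leq_sum => i _.
rewrite -[leqRHS]muln1 -[X in X * _]card_ord -sum_nat_const.
by apply: leq_sum => j _; apply: leq_b1.
Qed.

Definition wide_bound (p : pattern) (t w W : nat) : Prop :=
  forall (A : rel nat) m, ~ mcontains A p ->
    \sum_(i < m) nat_of_bool (w <= \sum_(j < t) nat_of_bool (A i j)) <= W.

Definition block (A : rel nat) (t a b : nat) : rel nat :=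
  fun x y => A (a * t + x) (b * t + y).

Definition nonempty_rows (A : rel nat) t : nat :=
  \sum_(x < t) nat_of_bool [exists y : 'I_t, A x y].

Lemma ones_blocks A N t :
  ones A (N * t) (N * t) = \sum_(a < N) \sum_(b < N) ones (block A t a b) t t.
Proof.
rewrite /ones (sum_blocks (fun i => \sum_(j < N * t) nat_of_bool (A i j))).
apply: eq_bigr => a _; rewrite [RHS]exchange_big; apply: eq_bigr => x _ /=.
exact: (sum_blocks (fun j => nat_of_bool (A (a * t + x) j))).
Qed.

Lemma mcontains_block A t a b p : mcontains (block A t a b) p -> mcontains A p.
Proof.
by apply: (@mcontains_sub _ _ _ (addn (a * t)) (addn (b * t))) => // i j; lia.
Qed.

(** Contracting each block of a strip to a single row turns its nonempty columns into ones, so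
    [wide] applies to the contracted strip. *)
Lemma wide_blocks_le A p t w W N b : wide_bound p t w W -> ~ mcontains A p ->
  \sum_(a < N) nat_of_bool (w <= nonempty_rows (mxT (block A t a b)) t) <= W.
Proof.
move=> wide nA; pose B := fun i j => contr t 1 A i (b * t + j).
apply: leq_trans (wide B N _); last first.
  move=> cB; apply: nA; apply: (@mcontains_contr t 1).
  by apply: (@mcontains_sub _ B _ id (addn (b * t))) cB => // i j; lia.
apply: leq_sum => a _; rewrite eq_leq //; congr (nat_of_bool (_ <= _)).
apply: eq_bigr => x _; congr nat_of_bool; rewrite /B /contr /mxT /block.
apply: eq_existsb => y; apply/idP/existsP => [Axy|[z]].
  by exists ord0; rewrite muln1 addn0.
by rewrite ord1 muln1 addn0.
Qed.

(* The Marcus-Tardos recursion: blocks with many nonempty columns or many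
   nonempty rows are few, the others contain at most a quarter of t ones, and
   the nonempty ones among them are counted by the contracted matrix. *)
Lemma marcus_tardos p t w W : 4 <= t -> 0 < W ->
  wide_bound p t w W -> wide_bound (inv_pattern p) t w W ->
  (forall A : rel nat, ~ mcontains A p -> nonempty_rows A t < w ->
     nonempty_rows (mxT A) t < w -> 4 * ones A t t <= t) ->
  ex_le (8 * W * t) p.
Proof.
move=> t4 W0 wide tall small A n; elim/ltn_ind: n A => n IH A nA.
have [nt|tn] := leqP n t.
  apply: leq_trans (ones_le _ _ _) _; rewrite leq_mul2r; apply/orP; right.
  by apply: leq_trans nt _; nia.
(* Padding to [N] blocks at most doubles the size because [t < n]; with [4 <= t] this still leaves
   [N < n]. *)
pose N := (n %/ t).+1.
have nN : n <= N * t by rewrite ltnW // ltn_ceil //; lia.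
have Nt2 : N * t <= 2 * n.
  by rewrite /N mulSn; have := leq_trunc_div n t; lia.
have Nn : N < n by nia.
apply: leq_trans (ones_mono A nN nN) _; rewrite ones_blocks.
have cell a b : 4 * ones (block A t a b) t t <=
    4 * t ^ 2 * nat_of_bool (w <= nonempty_rows (mxT (block A t a b)) t)
    + 4 * t ^ 2 * nat_of_bool (w <= nonempty_rows (block A t a b) t)
    + t * nat_of_bool (contr t t A a b).
  have Bt := ones_le (block A t a b) t t; rewrite expnS expn1.
  have [|w1] := leqP w (nonempty_rows (mxT _) t); first by nia.
  have [|w2] := leqP w (nonempty_rows (block _ _ _ _) t); first by nia.
  rewrite !muln0 !add0n.
  have [_|/existsPn A0] := boolP (contr t t A a b).
    rewrite muln1; apply: small => // cB.
    by apply: nA; apply: mcontains_block cB.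
  rewrite muln0 leqn0 muln_eq0 /= sum_nat_eq0; apply/forallP => x /=.
  rewrite sum_nat_eq0; apply/forallP => y /=; rewrite eqb0.
  by have /existsPn := A0 x; apply.
have total : 4 * (\sum_(a < N) \sum_(b < N) ones (block A t a b) t t) <=
    4 * t ^ 2 * (N * W) + 4 * t ^ 2 * (N * W) + t * (8 * W * t * N).
  have sumW (F : nat -> nat) : (forall b, F b <= W) -> \sum_(b < N) F b <= N * W.
    move=> FW; rewrite -[X in X * _]card_ord -sum_nat_const.
    by apply: leq_sum => b _.
  apply: leq_trans (_ : _ <= \sum_(a < N) \sum_(b < N)
    (4 * t ^ 2 * nat_of_bool (w <= nonempty_rows (mxT (block A t a b)) t)
    + 4 * t ^ 2 * nat_of_bool (w <= nonempty_rows (block A t a b) t)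
    + t * nat_of_bool (contr t t A a b))) _.
    rewrite big_distrr; apply: leq_sum => a _; rewrite big_distrr.
    by apply: leq_sum => b _; apply: cell.
  under eq_bigr do rewrite !big_split /=.
  rewrite !big_split /=; apply: leq_add; first apply: leq_add.
  - rewrite exchange_big /=; under eq_bigr do rewrite -big_distrr /=.
    rewrite -big_distrr leq_mul2l /=; apply/orP; right.
    apply: (sumW (fun b => \sum_(a < N)
      nat_of_bool (w <= nonempty_rows (mxT (block A t a b)) t))) => b.
    exact: wide_blocks_le wide nA.
  - under eq_bigr do rewrite -big_distrr /=.
    rewrite -big_distrr leq_mul2l /=; apply/orP; right.
    apply: (sumW (fun a => \sum_(b < N)
      nat_of_bool (w <= nonempty_rows (block A t a b) t))) => a.
    have nAT : ~ mcontains (mxT A) (inv_pattern p) by move=> /mcontainsT_inv.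
    exact: (wide_blocks_le N a tall nAT).
  - under eq_bigr do rewrite -big_distrr /=.
    rewrite -big_distrr leq_mul2l /=; apply/orP; right.
    by apply: IH => // /mcontains_contr.
(* The three terms add up to [16 * W * t * (N * t)], and [N * t <= 2 * n]. *)
have : 4 * (\sum_(a < N) \sum_(b < N) ones (block A t a b) t t) <=
    16 * W * t * (2 * n).
  by apply: leq_trans total _; rewrite expnS expn1; nia.
lia.
Qed.
End Matrices.
(** * Block patterns *)

Section Blocks.
Local Open Scope nat_scope.
Variable c : nat.
Implicit Types (A : rel nat) (P : 'I_c -> pattern).

(* Occurrences of the P i whose row ranges are ordered by al and whose column
   ranges are ordered by be; this form is stable under transposition. *)
Definition bcontains (A : rel nat) (al be : 'S_c) P :=
  exists r q : forall i, 'I_(plen (P i)) -> nat,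
    [/\ forall i, @occurrence A (P i) (r i) (q i),
        forall i j x y, al i < al j -> r i x < r j y &
        forall i j x y, be i < be j -> q i x < q j y].

Lemma bcontainsT A al be P : bcontains A al be P ->
  bcontains (mxT A) be al (fun i => inv_pattern (P i)).
Proof.
move=> [r [q [rq r_al q_be]]]; exists q, r; split=> // i.
exact: occurrenceT.
Qed.

(* The l-th interval of columns cut out by v is [cut v l, cut v l.+1), where
   cut v c = t. *)
Definition cut t (v : {ffun 'I_c -> 'I_t}) (l : nat) : nat :=
  if insub l is Some l' then nat_of_ord (v l') else t.

Lemma cutE t v (l : 'I_c) : cut (t := t) v l = v l.
Proof. by rewrite /cut valK. Qed.

Lemma cutc t v : cut (t := t) v c = t.
Proof. by rewrite /cut insubF // ltnn. Qed.

Definition split_row (A : rel nat) C t (v : {ffun 'I_c -> 'I_t}) (i : nat) :=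
  [forall l : 'I_c, C <
    \sum_(j < t) nat_of_bool (A i j && (cut v l <= j < cut v l.+1))].

Lemma split_rowP A C t i : 0 < t ->
  c * C.+1 <= \sum_(j < t) nat_of_bool (A i j) ->
  exists v : {ffun 'I_c -> 'I_t}, split_row A C v i.
Proof.
move=> t0; rewrite sum_bool_iota; set z := seq.filter _ _ => size_z.
have z_sorted : sorted ltn z.
  by apply: sorted_filter (iota_ltn_sorted _ _) => ? ? ?; apply: ltn_trans.
have zP x : x < size z -> (nth 0 z x < t) && A i (nth 0 z x).
  by move=> /(mem_nth 0); rewrite mem_filter mem_iota /= add0n andbC.
have zmono x y : x < y -> y < size z -> nth 0 z x < nth 0 z y.
  by move=> xy ys; apply: (sorted_ltn_nth ltn_trans) => //; rewrite inE; lia.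
(* Interval [l] begins at the one of index [l * C.+1], so it holds at least the next [C.+1] ones.
   The default of [insubd] is never reached. *)
pose v := [ffun l : 'I_c => insubd (Ordinal t0) (nth 0 z (l * C.+1))].
have vE (l : 'I_c) : v l = nth 0 z (l * C.+1) :> nat.
  have /andP[zt _] : (nth 0 z (l * C.+1) < t) && A i (nth 0 z (l * C.+1)).
    by apply: zP; have := ltn_ord l; nia.
  by rewrite ffunE val_insubd zt.
exists v; apply/forallP => l.
rewrite (sum_bool_iota (fun j => A i j && (cut v l <= j < cut v l.+1))).
pose s := [seq nth 0 z (l * C.+1 + x) | x <- iota 0 C.+1].
have lc := ltn_ord l.
have szl x : x < C.+1 -> l * C.+1 + x < size z by nia.
have <- : size s = C.+1 by rewrite size_map size_iota.
apply: uniq_leq_size.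
  rewrite map_inj_in_uniq ?iota_uniq // => x y; rewrite !mem_iota /= !add0n.
  move=> xC yC; have := zmono (l * C.+1 + x) (l * C.+1 + y).
  have := zmono (l * C.+1 + y) (l * C.+1 + x); have := szl x; have := szl y.
  lia.
move=> j /mapP[x]; rewrite mem_iota /= add0n => xC ->.
have /andP[zt Az] := zP _ (szl _ xC).
rewrite mem_filter mem_iota /= add0n zt Az andbT /= cutE vE.
apply/andP; split.
  case: x {zt Az} xC => [|x] xC; first by rewrite addn0.
  by apply/ltnW/zmono; [lia|apply: szl].
have [l1|l1] := ltnP l.+1 c; last first.
  by rewrite (_ : l.+1 = c) ?cutc //; lia.
rewrite -[l.+1]/(nat_of_ord (Ordinal l1)) cutE vE /=; apply: zmono => /=; nia.
Qed.

Lemma wide_bound_blocks P al be C p t : 0 < c -> 0 < t ->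
  (forall i, ex_le C (P i)) ->
  (forall A, bcontains A al be P -> mcontains A p) ->
  wide_bound p t (c * C.+1) (c * t * t ^ c).
Proof.
move=> c0 t0 PC Pp A m nA; rewrite leqNgt; apply/negP => wide.
apply/nA/Pp => {nA Pp}.
(* Pigeonhole over the [t ^ c] cut vectors: each wide row is split by at least one of them. *)
have [v v_rows] : exists v : {ffun 'I_c -> 'I_t},
    c * t <= \sum_(i < m) nat_of_bool (split_row A C v i).
  apply/existsP; rewrite -[X in is_true X]negbK; apply/negP => /existsPn few.
  have: \sum_(i < m) nat_of_bool (c * C.+1 <= \sum_(j < t) nat_of_bool (A i j)) <=
      \sum_(v : {ffun 'I_c -> 'I_t}) \sum_(i < m) nat_of_bool (split_row A C v i).
    rewrite exchange_big; apply: leq_sum => i _ /=.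
    have [/(split_rowP t0)[v vi]|//] := leqP (c * C.+1) _.
    by rewrite (bigD1 v) //= vi.
  apply/negP; rewrite -ltnNge; apply: leq_ltn_trans wide.
  apply: leq_trans (_ : _ <= \sum_(v : {ffun 'I_c -> 'I_t}) c * t) _.
    by apply: leq_sum => v _; rewrite ltnW // ltnNge few.
  by rewrite sum_nat_const card_ffun !card_ord mulnC.
have [rho [rho_mono rhoP _]] := increasing_enum (split_row A C v) m.
have rho_split i : i < c * t -> split_row A C v (rho i).
  by move=> /leq_trans/(_ v_rows)/rhoP/andP[].
(* Nothing forces [v] to be increasing a priori; it is, because a split row has ones in every
   interval. *)
have cut_lt l : l < c -> cut v l < cut v l.+1.
  move=> lc; rewrite ltnNge; apply/negP => cutl.
  have /forallP/(_ (Ordinal lc)) := rho_split 0 ltac:(nia).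
  by rewrite big1 // => j _; case: (A _ j) => //=; lia.
have cut_le l l' : l < l' -> l' <= c -> cut v l.+1 <= cut v l'.
  move=> ll'; have -> : l' = l.+1 + (l' - l.+1) by lia.
  elim: (l' - l.+1) => [|k IH] kc; first by rewrite addn0.
  apply: leq_trans (IH _) _; first by lia.
  by rewrite addnS ltnW // cut_lt //; lia.
(* The group of [t] rows numbered [al i], restricted to the column interval numbered [be i]. It has
   at least [t * C.+1 > C * t] ones, hence contains [P i]. *)
pose B (i : 'I_c) : rel nat := fun x y =>
  (x < t) && A (rho (al i * t + x)) y && (cut v (be i) <= y < cut v (be i).+1).
have B_P i : mcontains (B i) (P i).
  apply: contrapT => /(PC i _ t); apply/negP; rewrite -ltnNge.
  apply: leq_trans (_ : t * C.+1 <= _); first by nia.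
  rewrite -[X in X * _]card_ord -sum_nat_const; apply: leq_sum => x _.
  have /forallP/(_ (be i)) : split_row A C v (rho (al i * t + x)).
    by apply: rho_split; have := ltn_ord x; have := ltn_ord (al i); nia.
  move=> /leq_trans; apply; apply: leq_sum => j _.
  by rewrite /B ltn_ord andTb.
pose rq i := cid (B_P i).
pose r i := projT1 (rq i); pose q i := projT1 (cid (projT2 (rq i))).
have occ i : occurrence (B i) (r i) (q i).
  exact: (projT2 (cid (projT2 (rq i)))).
have rt i x : r i x < t.
  by have [_ _ /(_ x)] := occ i; rewrite /B => /andP[/andP[]].
have qcut i x : cut v (be i) <= q i x < cut v (be i).+1.
  have [_ _ /(_ ((pperm (P i))^-1%g x))] := occ i.
  by rewrite permKV => /andP[].
exists (fun i x => rho (al i * t + r i x)), q; split.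
- move=> i; apply: (@occurrence_sub _ (B i) _ _ _
    (fun x => rho (al i * t + x)) id) (occ i) => // [x y xy|x y].
    by apply: rho_mono; rewrite ltn_add2l.
  by move=> /andP[/andP[]].
- by move=> i j x y ij; apply: rho_mono; have := rt i x; nia.
- move=> i j x y ij; have /andP[_ qx] := qcut i x; have /andP[qy _] := qcut j y.
  apply: leq_trans qx (leq_trans _ qy); apply: cut_le ij _.
  exact: ltnW (ltn_ord _).
Qed.

(** With [w = c * C.+1], a block with fewer than [w] nonempty rows and columns has at most [w ^ 2]
    ones, a quarter of [t]. Transposition exchanges the two block orders and so reduces tall blocks
    to wide ones. *)
Lemma ex_le_blocks P (s : 'S_c) C p : 0 < c ->
  (forall i, ex_le C (P i)) ->
  (forall A, bcontains A 1%g s P -> mcontains A p) ->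
  let t := 4 * (c * C.+1) ^ 2 in ex_le (8 * (c * t * t ^ c) * t) p.
Proof.
move=> c0 PC Pp t.
have t4 : 4 <= t.
  by rewrite /t -[X in X <= _]muln1 leq_mul2l expn_gt0 muln_gt0 c0.
have t0 : 0 < t by apply: leq_trans t4.
apply: (marcus_tardos (w := c * C.+1)) => //.
- by rewrite !muln_gt0 c0 expn_gt0 t0.
- exact: wide_bound_blocks PC Pp.
- apply: (@wide_bound_blocks (fun i => inv_pattern (P i)) s 1%g) => // [i|A bA].
    exact: ex_le_inv.
  rewrite -[A]/(mxT (mxT A)); apply/mcontainsT/Pp.
  have := bcontainsT bA; congr (bcontains _ _ _ _).
  by apply/funext => i; rewrite inv_patternK.
move=> A _ rows cols; rewrite /t leq_mul2l /= expnS expn1.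
set w := c * C.+1 in rows cols *.
apply: leq_trans (_ : nonempty_rows A t * nonempty_rows (mxT A) t <= _); last first.
  by rewrite leq_mul // ltnW.
rewrite /ones /nonempty_rows big_distrl /=; apply: leq_sum => x _.
rewrite big_distrr /=; apply: leq_sum => y _.
case Axy: (A x y) => //=; rewrite muln_gt0 !lt0b.
by apply/andP; split; apply/existsP; [exists y|exists x].
Qed.

End Blocks.

(** * Inflations as block patterns *)

Section Inflations.
Local Open Scope nat_scope.

(** The blocks of an inflation come in index order by position, hence the identity for rows, and in
    the order of [s] by value. *)
Lemma bcontains_inflation c (s : 'S_c) (P : 'I_c -> pattern) A :
  bcontains A 1%g s P -> mcontains A (inflation s P).
Proof.
move=> [r [q [occ r_lt q_lt]]].
pose finj := @inflation_fun_inj _ s P.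
have pE : pperm (inflation s P) = perm finj by [].
exists (fun x => r (tagnat.sig1 x) (tagnat.sig2 x)).
exists (fun y => let x := (pperm (inflation s P))^-1%g y in
  q (tagnat.sig1 x) (pperm (P (tagnat.sig1 x)) (tagnat.sig2 x))).
split.
- move=> x y xy; have : (tagnat.sig x < tagnat.sig y)%O by rewrite tagnat.lt_sig.
  rewrite /tagnat.sig1 /tagnat.sig2.
  case: (tagnat.sig x) (tagnat.sig y) => [i u] [j v].
  rewrite ltEsig /= !leEord => /andP[ij /implyP uv].
  have [lij|ji] := ltnP i j; first by apply: r_lt; rewrite !perm1.
  have eij : i = j by apply: val_inj; apply: anti_leq; rewrite ij.
  move: (uv ji); case: _ / eij v uv {ij ji} => v _.
  by rewrite tagged_asE; have [rP _ _] := occ i; apply: rP.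
- move=> x y; rewrite pE.
  have [x' ->] : exists x', x = perm finj x' by exists ((perm finj)^-1%g x); rewrite permKV.
  have [y' ->] : exists y', y = perm finj y' by exists ((perm finj)^-1%g y); rewrite permKV.
  rewrite !permK !permE /= /inflation_val.
  move: (tagnat.sig1 x') (tagnat.sig2 x') (tagnat.sig1 y') (tagnat.sig2 y').
  move=> i u j v lt.
  have [lij|lji|/val_inj/perm_inj eij] := ltngtP (s i) (s j).
  + exact: q_lt.
  + have := block_start_lt P lji; have := ltn_ord (pperm (P j) v); lia.
  + case: _ / eij v lt => v; rewrite ltn_add2l.
    by have [_ qP _] := occ i; apply: qP.
- by move=> x; rewrite permK; have [_ _] := occ (tagnat.sig1 x).
Qed.
End Inflations.
(** * Counting systems of distinct representatives *)

Section Counting.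
Local Open Scope nat_scope.
Local Open Scope set_scope.

Lemma leq_ffact_exp n m : n ^_ m <= n ^ m.
Proof.
elim: m n => // m IH [|n] //; rewrite ffactnS expnS leq_mul2l /=.
apply: leq_trans (IH n) _; case: m {IH} => // m.
by rewrite leq_exp2r // leqnSn.
Qed.

Lemma leq_exp_ffact m n : m ^ n <= (m + n) ^_ n.
Proof.
elim: n => // n IH; rewrite addnS ffactnS /= expnS.
by apply: leq_mul => //; lia.
Qed.

Lemma leq_bin_exp n m : 'C(n, m) <= 2 ^ n.
Proof.
elim: n m => [|n IH] [|m] //; first by rewrite bin0 expn_gt0.
by rewrite binS expnS mul2n -addnn leq_add.
Qed.

(** The falling factorial of [2 * n] with [n] factors is a central binomial coefficient, at most
    [4 ^ n], times the factorial of [n]. *)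
Lemma leq_exp_fact n : n ^ n <= 4 ^ n * n`!.
Proof.
apply: leq_trans (leq_exp_ffact n n) _; rewrite -bin_ffact leq_mul2r.
by rewrite -[4]/(2 ^ 2) -expnM mul2n -addnn leq_bin_exp orbT.
Qed.

Section Representatives.
Variable T : finType.

(** The head set is served last and skips the elements already used by the tail. *)
Fixpoint sdr (D : seq {set T}) : seq (seq T) :=
  if D is X :: D' then
    [seq x :: g | g <- sdr D', x <- enum (X :\: [set y in g])]
  else [:: [::]].

Lemma sdr_uniq (D : seq {set T}) : uniq (sdr D).
Proof.
elim: D => //= X D IH; apply: allpairs_uniq_dep => // [g _|].
  exact: enum_uniq.
by move=> [g x] [h y] _ _ [-> ->].
Qed.

Lemma mem_sdr (D : seq {set T}) g : g \in sdr D ->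
  [/\ size g = size D, uniq g & forall x0 i, i < size D -> nth x0 g i \in nth finset.set0 D i].
Proof.
elim: D g => [|X D IH] g /=; first by rewrite inE => /eqP ->.
move=> /allpairsPdep[h [x [/IH[sh uh hD] + ->]]].
rewrite mem_enum !inE => /andP[xh xS]; split=> /=.
- by rewrite sh.
- by rewrite xh.
- by move=> x0 [|i] //= iD; apply: hD.
Qed.

Lemma size_sdr d (D : seq {set T}) : (forall X, X \in D -> d + size D <= #|X|) ->
  d ^ size D <= size (sdr D).
Proof.
elim: D => //= X D IH dD; rewrite size_allpairs_dep.
have {}IH : d ^ size D <= size (sdr D).
  apply: IH => X' X'D; apply: leq_trans (dD X' _); first by lia.
  by rewrite inE X'D orbT.
apply: leq_trans (_ : d * size (sdr D) <= _).
  by rewrite expnS leq_mul2l IH orbT.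
have : forall g, g \in sdr D -> d <= #|X :\: [set y in g]|.
  move=> g /mem_sdr[sg _ _]; rewrite cardsD.
  have gD : #|[set y in g]| <= size D by rewrite cardsE -sg card_size.
  have := leq_trans (subset_leq_card (finset.subsetIr X [set y in g])) gD.
  by have := dD X (mem_head _ _); rewrite /=; lia.
elim: (sdr D) => [|g s IHs] dS /=; first by rewrite muln0.
rewrite mulnS leq_add //; first by rewrite -cardE dS ?mem_head.
by apply: IHs => h hs; apply: dS; rewrite inE hs orbT.
Qed.

End Representatives.

Lemma card_sdr u (T : finType) d (B : 'I_u -> {set T}) :
  (forall i, d + u <= #|B i|) ->
  d ^ u <= #|[set g : {ffun 'I_u -> T} | injectiveb g && [forall i, g i \in B i]]|.
Proof.
case: u B => [|u] B dB; last first.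
  have [x0 _] : exists x, x \in B ord0.
    by apply/card_gt0P; apply: leq_trans (dB _); rewrite addnS.
  pose D := [seq B i | i <- enum 'I_u.+1].
  have sD : size D = u.+1 by rewrite size_map size_enum_ord.
  have nthD (i : 'I_u.+1) : nth finset.set0 D i = B i.
    by rewrite (nth_map i) ?size_enum_ord // nth_ord_enum.
  have : d ^ u.+1 <= size (sdr D).
    by rewrite -sD; apply: size_sdr => X /mapP[i _ ->]; rewrite sD.
  move=> /leq_trans; apply.
  pose F (g : seq T) := [ffun i : 'I_u.+1 => nth x0 g i].
  rewrite -(size_map F) cardE; apply: uniq_leq_size.
    rewrite map_inj_in_uniq ?sdr_uniq // => g h /mem_sdr[sg _ _] /mem_sdr[sh _ _].
    move=> /ffunP gh; apply: (@eq_from_nth _ x0); first by rewrite sg.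
    by rewrite sg sD => i iu; have := gh (Ordinal iu); rewrite !ffunE.
  move=> f /mapP[g /mem_sdr[sg ug gD] ->]; rewrite mem_enum inE.
  apply/andP; split; last first.
    by apply/forallP => i; rewrite ffunE -nthD gD ?sD.
  apply/injectiveP => i j; rewrite !ffunE => /eqP.
  by rewrite nth_uniq ?sg ?sD // => /eqP/val_inj.
have g0 : {ffun 'I_0 -> T} by apply: finfun => -[].
rewrite expn0 card_gt0; apply/finset.set0Pn; exists g0; rewrite inE.
by apply/andP; split; [apply/injectiveP|apply/forallP] => -[].
Qed.

Lemma std_exists u (g : 'I_u -> nat) : injective g ->
  exists s : 'S_u, forall i j, (s i < s j) = (g i < g j).
Proof.
move=> ginj.
pose rk i := #|[set j : 'I_u | g j < g i]|.
have rk_lt i j : g i < g j -> rk i < rk j.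
  move=> ij; apply: proper_card; apply/properP; split.
    by apply/fintype.subsetP => l; rewrite !inE => /ltn_trans; apply.
  by exists i; rewrite !inE ?ltnn.
have rk_u i : rk i < u.
  rewrite -[ltnRHS]card_ord -cardsT; apply: proper_card; apply/properP.
  by split; [exact: finset.subsetT|exists i; rewrite !inE ?ltnn].
pose f i := Ordinal (rk_u i).
have finj : injective f.
  move=> i j /(congr1 val) /= rij; apply: ginj.
  by have := @rk_lt i j; have := @rk_lt j i; lia.
exists (perm finj) => i j; rewrite !permE /=.
have := @rk_lt i j; have := @rk_lt j i.
by case: (ltngtP (g i) (g j)) => [||/ginj ->]; lia.
Qed.

(** The relative order fixes how many image points lie below [g i], and within a given image that
    number fixes [g i]. *)
Lemma eq_order_image u t (g g' : 'I_u -> 'I_t) :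
  injective g -> injective g' -> g @: finset.setT = g' @: finset.setT ->
  (forall i j, (g i < g j) = (g' i < g' j)) -> g =1 g'.
Proof.
move=> ginj g'inj im ord.
pose h (z : 'I_t) := #|[set y in g @: finset.setT | y < z]|.
have h_lt i (z : 'I_t) : g i < z -> h (g i) < h z.
  move=> iz; apply: proper_card; apply/properP; split.
    apply/fintype.subsetP => y; rewrite !inE => /andP[-> yi].
    exact: ltn_trans yi iz.
  by exists (g i); rewrite !inE ?ltnn ?andbF // imset_f //= iz.
have hE (f : 'I_u -> 'I_t) i : injective f -> f @: finset.setT = g @: finset.setT ->
    h (f i) = #|[set j | f j < f i]|.
  move=> finj fg; rewrite -(card_imset _ finj) /h -fg; congr #|pred_of_set _|.
  apply/setP => y; rewrite inE; apply/andP/imsetP => [[/imsetP[x _ ->] xi]|].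
    by exists x => //; rewrite inE.
  by move=> [x]; rewrite inE => xi ->; rewrite imset_f.
move=> i; apply/val_inj.
have hh : h (g i) = h (g' i).
  rewrite !hE //; apply: eq_card => j; rewrite !inE; exact: ord.
have [j _ gj] : exists2 j, j \in finset.setT & g' i = g j.
  by apply/imsetP; rewrite im imset_f.
have := h_lt i (g' i); have := h_lt j (g i); rewrite -gj hh.
by case: (ltngtP (g i) (g' i)) => // _; lia.
Qed.

(** An injection is recovered from its image and its standardization: there are ['C(t, u)] possible
    images, and the standardizations lie in [V]. *)
Lemma card_sdr_order u t d (B : 'I_u -> {set 'I_t}) (V : {set 'S_u}) :
  (forall i, d + u <= #|B i|) ->
  (forall (g : 'I_u -> 'I_t) (s : 'S_u), injective g -> (forall i, g i \in B i) ->
     (forall i j, (s i < s j) = (g i < g j)) -> s \in V) ->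
  d ^ u <= 'C(t, u) * #|V|.
Proof.
move=> dB BV; apply: leq_trans (card_sdr dB) _.
set G := [set g | _]%SET.
pose std (g : {ffun 'I_u -> 'I_t}) : 'S_u :=
  odflt 1%g [pick s : 'S_u | [forall i, forall j, (s i < s j) == (g i < g j)]].
have stdE (g : {ffun 'I_u -> 'I_t}) i j : injective g -> (std g i < std g j) = (g i < g j).
  move=> ginj; rewrite /std; case: pickP => [s /forallP/(_ i)/forallP/(_ j)/eqP //|].
  have [|s sP] := @std_exists _ (fun x => nat_of_ord (g x)).
    by move=> x y /val_inj/ginj.
  move=> /(_ s)/negP[]; apply/forallP => x; apply/forallP => y.
  by rewrite sP.
have GP (g : {ffun 'I_u -> 'I_t}) : g \in G -> injective g /\ forall i, g i \in B i.
  by rewrite inE => /andP[/injectiveP ginj /forallP].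
pose F (g : {ffun 'I_u -> 'I_t}) := (g @: finset.setT, std g).
rewrite -[X in 'C(X, _)](card_ord t) -card_draws -cardsX.
rewrite -(card_in_imset (f := F)).
  apply: subset_leq_card; apply/fintype.subsetP => _ /imsetP[g /GP[ginj gB] ->].
  rewrite !inE card_imset // cardsT card_ord eqxx /=.
  by apply: (BV g) => // i j; rewrite stdE.
move=> g g' /GP[ginj _] /GP[g'inj _] [im st]; apply/ffunP.
by apply: eq_order_image => // i j; rewrite -!stdE // st.
Qed.

(* Each system of distinct columns is determined by its set of columns and a
   permutation avoiding p. *)
Lemma kst p l A u t (rho kap : nat -> nat) :
  (forall n, #|Av n p| <= l ^ n) -> ~ mcontains A p -> 0 < u ->
  {homo rho : i j / i < j} -> {homo kap : i j / i < j} ->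
  (forall i, i < u -> 2 * u <= \sum_(j < t) nat_of_bool (A (rho i) (kap j))) ->
  u * u <= 4 * t * l.
Proof.
move=> pl nA u0 rhoP kapP wide.
pose B (i : 'I_u) := [set j : 'I_t | A (rho i) (kap j)]%SET.
have key : u ^ u <= 'C(t, u) * l ^ u.
  apply: leq_trans (leq_mul (leqnn _) (pl u)); apply: (card_sdr_order (B := B)).
    move=> i; rewrite addnn -mul2n; apply: leq_trans (wide _ (ltn_ord i)) _.
    rewrite -sum1_card [leqRHS]big_mkcond /=; apply: leq_sum => j _.
    by rewrite inE; case: (A _ _).
  move=> g s ginj gB sg; rewrite inE; apply/negP => /existsP[f].
  move=> /andP[/forallP fP /forallP sP]; apply: nA.
  exists (fun x => rho (f x)), (fun y => kap (g (f ((pperm p)^-1%g y)))).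
  split=> [x y xy|x y xy|x].
  - by apply: rhoP; have /forallP/(_ y) := fP x; rewrite xy.
  - apply: kapP; rewrite -sg.
    by have /forallP/(_ ((pperm p)^-1%g y))/eqP -> := sP ((pperm p)^-1%g x);
      rewrite !permKV.
  - by rewrite permK; have := gB (f x); rewrite inE.
(* Multiplying [key] by [leq_exp_fact] turns the binomial into a falling factorial, at most [t ^ u];
   it remains to take [u]-th roots. *)
have : (u * u) ^ u <= (4 * t * l) ^ u.
  rewrite !expnMn; apply: leq_trans (leq_mul key (leq_exp_fact u)) _.
  have := leq_ffact_exp t u; rewrite -bin_ffact => bt.
  have -> : 'C(t, u) * l ^ u * (4 ^ u * u`!) = 4 ^ u * ('C(t, u) * u`!) * l ^ u by lia.
  by rewrite leq_mul2r leq_mul2l bt !orbT.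
by rewrite leq_exp2r.
Qed.

End Counting.
(** * From growth rates to linear constants *)

Section ExtremalFromCounting.
Local Open Scope nat_scope.

Definition graph n (s : 'S_n) : rel nat := fun i j =>
  [exists x : 'I_n, (x == i :> nat) && (s x == j :> nat)].

Lemma contains_graph n (s : 'S_n) p : contains s p <-> mcontains (graph s) p.
Proof.
split=> [/existsP[f /andP[/forallP fP /forallP sP]]|[r [q [rP qP rq]]]].
  exists (fun x => nat_of_ord (f x)), (fun y => nat_of_ord (s (f ((pperm p)^-1%g y)))).
  split=> [x y xy|x y xy|x].
  - by have /forallP/(_ y) := fP x; rewrite xy.
  - by have /forallP/(_ ((pperm p)^-1%g y))/eqP -> := sP ((pperm p)^-1%g x);
      rewrite !permKV.
  - by apply/existsP; exists (f x); rewrite permK !eqxx.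
have /choice[f fP] x : exists z : 'I_n, z = r x :> nat /\ s z = q (pperm p x) :> nat.
  by have /existsP[z /andP[/eqP zr /eqP zq]] := rq x; exists z.
apply/existsP; exists (finfun f); apply/andP; split.
  apply/forallP => x; apply/forallP => y; apply/implyP => xy; rewrite !ffunE.
  by have [-> _] := fP x; have [-> _] := fP y; apply: rP.
apply/forallP => x; apply/forallP => y; rewrite !ffunE.
have [_ ->] := fP x; have [_ ->] := fP y; apply/eqP.
have := qP (pperm p x) (pperm p y); have := qP (pperm p y) (pperm p x).
by case: (ltngtP (pperm p x) (pperm p y)) => [||/val_inj ->]; rewrite ?ltnn //; lia.
Qed.

Lemma mxT_graph n (s : 'S_n) : mxT (graph s) = graph s^-1%g.
Proof.
apply/funext => i; apply/funext => j; apply/existsP/existsP => -[x /andP[/eqP xi /eqP sj]].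
- by exists (s x); rewrite permK sj xi !eqxx.
- by exists (s^-1%g x); rewrite permKV sj xi !eqxx.
Qed.

Lemma card_Av_inv n p : #|Av n (inv_pattern p)| = #|Av n p|.
Proof.
rewrite -(card_imset (Av n p) (@invg_inj _)); apply: eq_card => s.
rewrite (can_imset_pre _ invgK) !inE; congr (~~ _); apply/idP/idP.
- move=> /contains_graph; rewrite -[s in graph s]invgK -mxT_graph.
  by move=> /mcontainsT_inv/contains_graph.
- move=> /contains_graph/mcontainsT; rewrite mxT_graph invgK.
  by move=> /contains_graph.
Qed.

Lemma wide_bound_Av p l u t : (forall n, #|Av n p| <= l ^ n) ->
  0 < u -> 4 * t * l < u * u -> wide_bound p t (2 * u) u.
Proof.
move=> pl u0 ut A m nA.
have [rho [rho_mono rhoP _]] := increasing_enum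
  (fun i => 2 * u <= \sum_(j < t) nat_of_bool (A i j)) m.
rewrite leqNgt; apply/negP => wide; move: ut; apply/negP; rewrite -leqNgt.
apply: (kst (rho := rho) (kap := id) pl nA) => // i iu.
by have /andP[] := rhoP i (ltn_trans iu wide).
Qed.

(** By [kst] on the fewer than [2 * u] nonempty columns, at most [v] rows have [2 * v] ones or more,
    and these have at most [2 * u] each. The other nonempty rows, fewer than [2 * u], have fewer
    than [2 * v] each. *)
Lemma ones_small_Av p l A u v t : (forall n, #|Av n p| <= l ^ n) ->
  ~ mcontains A p -> 0 < v -> 8 * l * u < v * v ->
  nonempty_rows A t < 2 * u -> nonempty_rows (mxT A) t < 2 * u ->
  ones A t t <= 6 * u * v.
Proof.
move=> pl nA v0 uv rows cols.
set k := nonempty_rows (mxT A) t in cols.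
have [kap [kap_mono kapP kap_sum]] :=
  increasing_enum (fun y => [exists x : 'I_t, A x y]) t.
have row_sum (i : 'I_t) : \sum_(j < t) nat_of_bool (A i j) =
    \sum_(j < k) nat_of_bool (A i (kap j)).
  rewrite -(kap_sum (fun j => nat_of_bool (A i j))) [RHS]big_mkcond /=.
  apply: eq_bigr => j _; case: existsP => // nAj.
  by case Aij: (A i j) => //; case: nAj; exists i.
have row_le (i : 'I_t) : \sum_(j < t) nat_of_bool (A i j) <= 2 * u.
  rewrite row_sum; apply: leq_trans (ltnW cols).
  rewrite -[leqRHS]card_ord -sum1_card; apply: leq_sum => j _; exact: leq_b1.
have heavy : \sum_(i < t) nat_of_bool (2 * v <= \sum_(j < t) nat_of_bool (A i j)) <= v.
  rewrite leqNgt; apply/negP => heavy.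
  have [rho [rho_mono rhoP _]] := increasing_enum
    (fun i => 2 * v <= \sum_(j < t) nat_of_bool (A i j)) t.
  have : v * v <= 4 * k * l.
    apply: (kst (rho := rho) (kap := kap) pl nA) => // i iv.
    have /andP[it] := rhoP i (ltn_trans iv heavy).
    by rewrite (row_sum (Ordinal it)).
  by nia.
apply: leq_trans (_ : _ <= \sum_(i < t) (2 * v * nat_of_bool [exists j : 'I_t, A i j]
   + 2 * u * nat_of_bool (2 * v <= \sum_(j < t) nat_of_bool (A i j)))) _.
  apply: leq_sum => i _; have [|light] := leqP (2 * v) _.
    by rewrite muln1 => _; apply: leq_trans (row_le i) (leq_addl _ _).
  rewrite muln0 addn0; case: existsP => [_|nAi].
    by rewrite muln1; apply: ltnW.
  rewrite big1 // => j _; case Aij: (A i j) => //; case: nAi; by exists j.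
rewrite big_split -!big_distrr /= -/(nonempty_rows A t).
apply: leq_trans (leq_add (leq_mul (leqnn _) (ltnW rows))
  (leq_mul (leqnn _) heavy)) _.
by lia.
Qed.

Lemma ex_le_Av : exists K, forall p l, 0 < l -> (forall n, #|Av n p| <= l ^ n) ->
  ex_le (K * l ^ 8) p.
Proof.
(* The parameters solve three constraints: [108 * l < x] gives [4 * t * l < u * u], the factors 8
   and 9 give [8 * l * u < v * v], and [1728 = 24 * 8 * 9] gives [4 * (6 * u * v) = t]. *)
have [n n108] : exists n, 108 < n by exists 109.
exists (8 * (8 * n ^ 2) * (1728 * n ^ 3)) => p l l0 pl.
have [x xE] : exists x, x = n * l by exists (n * l).
have [u uE] : exists u, u = 8 * l * x ^ 2 by exists (8 * l * x ^ 2).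
have [v vE] : exists v, v = 9 * l * x by exists (9 * l * x).
have [t tE] : exists t, t = 1728 * l ^ 2 * x ^ 3 by exists (1728 * l ^ 2 * x ^ 3).
have x0 : 0 < x by rewrite xE muln_gt0 l0; lia.
have lx : 108 * l < x by rewrite xE ltn_mul2r l0.
have xk k : 0 < x ^ k by rewrite expn_gt0 x0.
have lk k : 0 < l ^ k by rewrite expn_gt0 l0.
have u0 : 0 < u by have := xk 2; rewrite uE; nia.
have v0 : 0 < v by rewrite vE; nia.
have tu : 4 * t * l < u * u.
  have -> : 4 * t * l = 64 * l ^ 2 * x ^ 3 * (108 * l) by rewrite tE; lia.
  have -> : u * u = 64 * l ^ 2 * x ^ 3 * x by rewrite uE; lia.
  by rewrite ltn_mul2l lx andbT; have := xk 3; have := lk 2; nia.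
have uv : 8 * l * u < v * v.
  have -> : 8 * l * u = 64 * (l ^ 2 * x ^ 2) by rewrite uE; lia.
  have -> : v * v = 81 * (l ^ 2 * x ^ 2) by rewrite vE; lia.
  by have := xk 2; have := lk 2; nia.
have -> : 8 * (8 * n ^ 2) * (1728 * n ^ 3) * l ^ 8 = 8 * u * t.
  by rewrite uE tE xE; lia.
apply: (marcus_tardos (w := 2 * u)) => //.
- by rewrite tE; have := lk 2; have := xk 3; nia.
- exact: wide_bound_Av pl u0 tu.
- by apply: wide_bound_Av u0 tu => m; rewrite card_Av_inv.
move=> A nA rows cols.
have small := ones_small_Av pl nA v0 uv rows cols.
apply: leq_trans (_ : 4 * (6 * u * v) <= _); first by rewrite leq_mul2l small.
by rewrite tE uE vE; lia.
Qed.

End ExtremalFromCounting.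
(** * From linear constants to growth rates *)

Section CountingFromExtremal.
Local Open Scope nat_scope.
Local Open Scope set_scope.

(** AM-GM with denominators cleared, so that it can be stated in [nat]. *)
Lemma nat_AGM n (d : 'I_n -> nat) : \prod_(i < n) (n * d i) <= (\sum_(i < n) d i) ^ n.
Proof.
rewrite -(ler_nat int) natrX natr_sum natr_prod.
have [|+ _] := @leif_AGM_scaled int 'I_n predT (fun i => (d i)%:R)%R.
  by move=> i _; rewrite mulrn_wge0.
rewrite card_ord; apply: le_trans; rewrite le_eqVlt; apply/orP; left.
by apply/eqP/eq_bigr => i _; rewrite natrM mulr_natl.
Qed.

Definition rel_of m (N : {set 'I_m * 'I_m}) : rel nat := fun i j =>
  [exists z in N, (z.1 == i :> nat) && (z.2 == j :> nat)].

Definition mx_of m (A : rel nat) : {set 'I_m * 'I_m} := [set z : 'I_m * 'I_m | A z.1 z.2].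

Definition AvM m p : {set {set 'I_m * 'I_m}} :=
  [set N | `[< ~ mcontains (rel_of N) p >] ].

Lemma rel_of_ord m (N : {set 'I_m * 'I_m}) (i j : 'I_m) :
  rel_of N i j = ((i, j) \in N).
Proof.
apply/existsP/idP => [[[a b] /andP[abN /andP[/eqP/val_inj <- /eqP/val_inj <-]]]//|].
by move=> ijN; exists (i, j); rewrite ijN /= !eqxx.
Qed.

Lemma rel_of_mx m (A : rel nat) i j : rel_of (mx_of m A) i j -> A i j.
Proof.
by move=> /existsP[z /andP[+ /andP[/eqP <- /eqP <-]]]; rewrite inE.
Qed.

Lemma mx_of_Av m A p : ~ mcontains A p -> mx_of m A \in AvM m p.
Proof.
move=> nA; rewrite inE; apply/asboolP => cA; apply: nA.
by apply: (@mcontains_sub _ _ _ id id) cA => // i j /rel_of_mx.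
Qed.

Lemma card_mx_of m A : #|mx_of m A| = ones A m m.
Proof.
rewrite -sum1_card /ones pair_bigA big_mkcond /=; apply: eq_bigr => z _.
by rewrite inE; case: (A _ _).
Qed.

Definition blowup t (A : rel nat) : rel nat := fun i j => A (i %/ t) (j %/ t).

Lemma ones_blowup t A m : 0 < t -> ones (blowup t A) (m * t) (m * t) = t * t * ones A m m.
Proof.
move=> t0; rewrite ones_blocks /ones big_distrr; apply: eq_bigr => a _.
rewrite big_distrr; apply: eq_bigr => b _ /=.
rewrite (eq_bigr (fun=> t * nat_of_bool (A a b))) => [|x _].
  by rewrite sum_nat_const card_ord mulnA.
rewrite (eq_bigr (fun=> nat_of_bool (A a b))) => [|y _].
  by rewrite sum_nat_const card_ord.
by rewrite /block /blowup !divnMDl // !divn_small // !addn0.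
Qed.

Lemma blowup_contr t m (A : rel nat) i j : i < m * t -> j < m * t -> A i j ->
  blowup t (rel_of (mx_of m (contr t t A))) i j.
Proof.
move=> im jm Aij.
have t0 : 0 < t by case: t im {jm} => //; rewrite muln0.
have im' : i %/ t < m by rewrite ltn_divLR.
have jm' : j %/ t < m by rewrite ltn_divLR.
rewrite /blowup; apply/existsP; exists (Ordinal im', Ordinal jm').
rewrite !eqxx inE /= andbT; apply/existsP; exists (Ordinal (ltn_pmod i t0)).
by apply/existsP; exists (Ordinal (ltn_pmod j t0)); rewrite /= -!divn_eq.
Qed.

Lemma ones_AvM C m p N : ex_le C p -> N \in AvM m p -> ones (rel_of N) m m <= C * m.
Proof. by move=> pC; rewrite inE => /asboolP/pC. Qed.

(* A matrix is a subset of the blow-up of its contraction. *)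
Lemma card_AvM_double C m p : ex_le C p ->
  #|AvM (m * 2) p| <= #|AvM m p| * 16 ^ (C * m).
Proof.
move=> pC; pose F (M : {set 'I_(m * 2) * 'I_(m * 2)}) := mx_of m (contr 2 2 (rel_of M)).
rewrite -sum1_card (partition_big F (fun N => N \in AvM m p)) /=.
  rewrite -sum_nat_const; apply: leq_sum => N NAv; rewrite sum1_card.
  (* The fibre over [N] consists of subsets of a blow-up with at most [4 * (C * m)] ones. *)
  apply: leq_trans (_ : _ <= #|powerset (mx_of (m * 2) (blowup 2 (rel_of N)))|) _.
    apply: subset_leq_card; apply/fintype.subsetP => M /andP[_ /eqP <-].
    rewrite inE; apply/fintype.subsetP => -[i j] ijM; rewrite inE /=.
    by apply: blowup_contr => //; rewrite rel_of_ord.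
  rewrite card_powerset card_mx_of ones_blowup // -[16]/(2 ^ 4) -expnM.
  by rewrite leq_exp2l // leq_mul2l /=; apply: ones_AvM NAv.
move=> M; rewrite inE => /asboolP nM; apply: mx_of_Av.
by move=> /mcontains_contr.
Qed.

Lemma card_AvM_le m p : #|AvM m p| <= 2 ^ (m * m).
Proof.
have <- : #|powerset (finset.setT : {set 'I_m * 'I_m})| = 2 ^ (m * m).
  by rewrite card_powerset cardsT card_prod card_ord.
apply: subset_leq_card; apply/fintype.subsetP => N _.
by rewrite inE finset.subsetT.
Qed.

(** Doubling the size from [m] adds [C * m] to the exponent, which therefore doubles as well. *)
Lemma card_AvM C j p : 0 < C -> ex_le C p -> #|AvM (2 ^ j) p| <= 16 ^ (C * 2 ^ j).
Proof.
move=> C0 pC; elim: j => [|j IH].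
  apply: leq_trans (card_AvM_le _ _) _.
  rewrite expn0 !muln1.
  by apply: (@leq_trans (16 ^ 1)) => //; rewrite leq_exp2l.
rewrite expnSr; apply: leq_trans (card_AvM_double _ pC) _.
by rewrite mulnA muln2 -addnn expnD leq_mul2r IH orbT.
Qed.

Lemma card_perm_rows n (B : 'I_n -> pred 'I_n) :
  #|[set s : 'S_n | [forall i, B i (s i)]]| <= \prod_(i < n) \sum_(j < n) nat_of_bool (B i j).
Proof.
rewrite bigA_distr_bigA /=.
pose F (s : 'S_n) : {ffun 'I_n -> 'I_n} := [ffun i => s i].
have Finj : injective F.
  by move=> s s' /ffunP ss'; apply/permP => i; have := ss' i; rewrite !ffunE.
rewrite -(card_imset _ Finj) -sum1_card big_mkcond /=; apply: leq_sum => f _.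
case: imsetP => // -[s + ->]; rewrite inE => /forallP sB.
by rewrite big1 // => i _; rewrite ffunE sB.
Qed.

(** The count is at most the product of the row sums of the blow-up. Their total is at most
    [n * (t * C)], so AM-GM bounds the product by the case of equal sums [t * C]. *)
Lemma card_perm_blowup n t A C m : n = m * t -> 0 < t -> 0 < m -> ones A m m <= C * m ->
  #|[set s : 'S_n | [forall i : 'I_n, blowup t A i (s i)]]| <= (t * C) ^ n.
Proof.
move=> nE t0 m0 AC; apply: leq_trans (card_perm_rows (fun i j : 'I_n => blowup t A i j)) _.
have n0 : 0 < n by rewrite nE muln_gt0 m0.
have prodn : n ^ n = \prod_(i < n) n by rewrite prod_nat_const card_ord.
rewrite -(@leq_pmul2l (n ^ n)) ?expn_gt0 ?n0 // -expnMn prodn -big_split /=.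
apply: leq_trans (nat_AGM _) _; rewrite leq_exp2r //.
have := @ones_blowup t A m t0; rewrite {1}/ones -nE => ->.
apply: leq_trans (leq_mul (leqnn _) AC) _.
by rewrite nE; lia.
Qed.

Lemma card_Av_pow C j p : 0 < C -> ex_le C p ->
  #|Av (2 ^ j * C) p| <= (16 * C ^ 2) ^ (2 ^ j * C).
Proof.
move=> C0 pC; pose m := 2 ^ j; rewrite -/m.
pose F (s : 'S_(m * C)) := mx_of m (contr C C (graph s)).
rewrite -sum1_card (partition_big F (fun N => N \in AvM m p)) /=.
  apply: leq_trans (_ : _ <= \sum_(N in AvM m p) (C * C) ^ (m * C)) _.
    apply: leq_sum => N NAv; rewrite sum1_card.
    apply: leq_trans (card_perm_blowup (erefl (m * C)) C0 _ (ones_AvM pC NAv)); last first.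
      by rewrite expn_gt0.
    apply: subset_leq_card; apply/fintype.subsetP => s /andP[_ /eqP <-].
    rewrite inE; apply/forallP => i; apply: blowup_contr => //.
    by apply/existsP; exists i; rewrite !eqxx.
  rewrite sum_nat_const [in leqRHS]expnMn -mulnn [m * C]mulnC.
  by rewrite leq_mul2r card_AvM ?orbT.
move=> s; rewrite inE => /negP ns; apply: mx_of_Av => cs; apply: ns.
by apply/contains_graph/mcontains_contr/cs.
Qed.

End CountingFromExtremal.
(** * Existence of the Stanley-Wilf limit *)

Section Supermultiplicativity.
Local Open Scope nat_scope.
Local Open Scope set_scope.

(** The flag [b] selects the skew sum, left summand above the right one; otherwise the sum is
    direct. *)
Definition sum_val m n (b : bool) (z : 'S_m * 'S_n) (i : 'I_(m + n)) : nat :=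
  match fintype.split i with
  | inl x => z.1 x + (if b then n else 0)
  | inr y => z.2 y + (if b then 0 else m)
  end.

Lemma sum_val_inj m n b z : injective (@sum_val m n b z).
Proof.
move=> i j; rewrite /sum_val.
case: (split_ordP i) => x ->; case: (split_ordP j) => y ->;
  rewrite ?(unsplitK (inl _)) ?(unsplitK (inr _)).
- by move=> /addIn/val_inj/perm_inj ->.
- by have := ltn_ord (z.1 x); have := ltn_ord (z.2 y); case: b; lia.
- by have := ltn_ord (z.2 x); have := ltn_ord (z.1 y); case: b; lia.
- by move=> /addIn/val_inj/perm_inj ->.
Qed.

Lemma perm_eq_order n (s s' : 'S_n) :
  (forall i j, (s i < s j) = (s' i < s' j)) -> s = s'.
Proof.
move=> ss'; apply/permP; apply: eq_order_image => //; try exact: perm_inj.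
have im (w : 'S_n) : w @: finset.setT = finset.setT.
  by apply/eqP; rewrite eqEcard finset.subsetT (card_imset _ (@perm_inj _ w)) leqnn.
by rewrite !im.
Qed.

(* If the first value of p is below its last one, then a skew sum of two
   permutations avoiding p avoids p: in an occurrence meeting both summands the
   first entry would lie above the last one. Otherwise use a direct sum. *)
Lemma card_Av_super p m n : 1 < plen p ->
  #|Av m p| * #|Av n p| <= #|Av (m + n) p|.
Proof.
case: p => [[|[|k]]] // pi _.
set p : pattern := existT (fun n => 'S_n) k.+2 pi; pose b := pi ord0 < pi ord_max.
have /choice[F FP] : forall z : 'S_m * 'S_n, exists s : 'S_(m + n),
    forall i j, (s i < s j) = (sum_val b z i < sum_val b z j).
  by move=> z; apply: std_exists; apply: sum_val_inj.
have valL (z : 'S_m * 'S_n) x : sum_val b z (lshift n x) = z.1 x + (if b then n else 0).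
  by rewrite /sum_val (unsplitK (inl _)).
have valR (z : 'S_m * 'S_n) y : sum_val b z (rshift m y) = z.2 y + (if b then 0 else m).
  by rewrite /sum_val (unsplitK (inr _)).
have Finj : injective F.
  move=> z z' zz'.
  have ord i j : (sum_val b z i < sum_val b z j) = (sum_val b z' i < sum_val b z' j).
    by rewrite -!FP zz'.
  rewrite [z]surjective_pairing [z']surjective_pairing; congr (_, _).
    apply: perm_eq_order => i j.
    by have := ord (lshift n i) (lshift n j); rewrite !valL !ltn_add2r.
  apply: perm_eq_order => i j.
  by have := ord (rshift m i) (rshift m j); rewrite !valR !ltn_add2r.
rewrite -cardsX -(card_imset _ Finj); apply: subset_leq_card.
apply/fintype.subsetP => _ /imsetP[z + ->]; rewrite !inE => /andP[z1 z2].
apply/negP => /existsP[f /andP[/forallP fP /forallP sP]].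
have f_lt (x y : 'I_k.+2) : x < y -> f x < f y.
  by move=> xy; have /forallP/(_ y) := fP x; rewrite xy.
have F_lt (x y : 'I_k.+2) : (sum_val b z (f x) < sum_val b z (f y)) = (pi x < pi y).
  by rewrite -FP; have /forallP/(_ y)/eqP := sP x.
have f_le (x y : 'I_k.+2) : x <= y -> f x <= f y.
  by rewrite leq_eqVlt => /orP[/eqP/val_inj ->//|/f_lt/ltnW].
have [fmax|fmax] := ltnP (f ord_max) m.
  have /choice[g gP] (x : 'I_k.+2) : exists y, f x = lshift n y.
    have fx : f x < m by apply: leq_ltn_trans fmax; apply: f_le; rewrite -ltnS.
    by exists (Ordinal fx); apply: val_inj.
  case/negP: z1; apply/existsP; exists (finfun g); apply/andP; split.
    apply/forallP => x; apply/forallP => y; apply/implyP => /f_lt.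
    by rewrite !ffunE !gP.
  apply/forallP => x; apply/forallP => y; rewrite !ffunE.
  by have := F_lt x y; rewrite !gP !valL ltn_add2r => ->.
have [f0|f0] := ltnP (f ord0) m; last first.
  have /choice[g gP] (x : 'I_k.+2) : exists y, f x = rshift m y.
    have fx : m <= f x by apply: leq_trans f0 _; apply: f_le.
    have fxm : f x - m < n by have := ltn_ord (f x); lia.
    by exists (Ordinal fxm); apply: val_inj; rewrite /= subnKC.
  case/negP: z2; apply/existsP; exists (finfun g); apply/andP; split.
    apply/forallP => x; apply/forallP => y; apply/implyP => /f_lt.
    by rewrite !ffunE !gP /= ltn_add2l.
  apply/forallP => x; apply/forallP => y; rewrite !ffunE.
  by have := F_lt x y; rewrite !gP !valR ltn_add2r => ->.
have [x fx] : exists x, f ord0 = lshift n x.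
  by exists (Ordinal f0); apply: val_inj.
have [y fy] : exists y, f ord_max = rshift m y.
  have fm : f ord_max - m < n by have := ltn_ord (f ord_max); lia.
  by exists (Ordinal fm); apply: val_inj; rewrite /= subnKC.
have := F_lt ord0 ord_max; rewrite fx fy valL valR -/b.
by case: (z.1 x) => u um; case: (z.2 y) => v vn /=; case: (b); lia.
Qed.

Lemma contains_leq n (s : 'S_n) p : contains s p -> plen p <= n.
Proof.
move=> /existsP[f /andP[/forallP fP _]].
rewrite -[plen p]card_ord -[n in _ <= n]card_ord; apply: (leq_card f).
move=> x y fxy; have [xy|yx|/val_inj//] := ltngtP x y.
- by have /forallP/(_ y) := fP x; rewrite xy fxy ltnn.
- by have /forallP/(_ x) := fP y; rewrite yx fxy ltnn.
Qed.

(** The one-point permutation avoids [p], and supermultiplicativity adds such points one at a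
    time. *)
Lemma card_Av_gt0 n p : 1 < plen p -> 0 < #|Av n p|.
Proof.
move=> p1; elim: n => [|n IH].
  apply/card_gt0P; exists 1%g; rewrite inE; apply/negP => /contains_leq.
  by move: p1; lia.
have Av1 : 0 < #|Av 1 p|.
  apply/card_gt0P; exists 1%g; rewrite inE; apply/negP => /contains_leq.
  by move: p1; lia.
by rewrite -[n.+1]addn1; apply: leq_trans (card_Av_super _ _ p1); rewrite muln_gt0 IH.
Qed.

Lemma card_Av_mono m n p : 1 < plen p -> m <= n -> #|Av m p| <= #|Av n p|.
Proof.
move=> p1 mn; rewrite -(subnKC mn); apply: leq_trans (card_Av_super _ _ p1).
by rewrite leq_pmulr // card_Av_gt0.
Qed.

Definition point_pattern : pattern := Tagged (fun n => 'S_n) (1%g : 'S_1).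

Lemma ex_le_point : ex_le 0 point_pattern.
Proof.
move=> A n nA; rewrite leqn0 sum_nat_eq0; apply/forallP => i /=.
rewrite sum_nat_eq0; apply/forallP => j /=; rewrite eqb0; apply/negP => Aij.
apply: nA; exists (fun=> nat_of_ord i), (fun=> nat_of_ord j).
by split=> [x y|x y|//]; rewrite !ord1.
Qed.

(* Every permutation is an inflation of itself by points. *)
Lemma ex_le_exists p : 0 < plen p -> exists2 C, 0 < C & ex_le C p.
Proof.
case: p => k pi /= k0.
have pts A : bcontains A 1%g pi (fun=> point_pattern) ->
    mcontains A (Tagged (fun n => 'S_n) pi).
  move=> [r [q [rq r_lt q_lt]]].
  exists (fun x => r x ord0), (fun y => q (pi^-1 y)%g ord0).
  split=> [x y xy|x y xy|x]; first by apply: r_lt; rewrite !perm1.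
    by apply: q_lt; rewrite !permKV.
  have [_ _ /(_ ord0)] := rq x; rewrite permK.
  by rewrite (ord1 (pperm point_pattern ord0)).
have /= := ex_le_blocks k0 (fun=> ex_le_point) pts.
set C := (X in ex_le X _) => CP; exists C.+1 => // A n nA.
by apply: leq_trans (CP A n nA) _; rewrite leq_mul2r leqnSn orbT.
Qed.

Lemma card_Av_exp p : 1 < plen p -> exists B, forall n, #|Av n p| <= B ^ n.
Proof.
move=> p1; have [C C0 pC] := ex_le_exists (ltnW p1).
exists ((16 * C ^ 2) ^ (2 * C)) => -[|n].
  by rewrite expn0; apply: leq_trans (max_card _) _; rewrite card_Sn.
(* The length is rounded up to a power of two at most twice as large, whence the exponent [2 * C] in
   the base. *)
rewrite -expnM; pose j := (trunc_log 2 n.+1).+1.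
have nj : n.+1 <= 2 ^ j by rewrite ltnW // trunc_log_ltn.
have jn : 2 ^ j <= 2 * n.+1 by rewrite expnS leq_mul2l trunc_logP.
apply: leq_trans (_ : #|Av (2 ^ j * C) p| <= _).
  by apply: card_Av_mono => //; nia.
apply: leq_trans (card_Av_pow _ C0 pC) _; apply: leq_pexp2l; first by nia.
by rewrite mulnAC leq_mul2r jn orbT.
Qed.

End Supermultiplicativity.

(** * Fekete's lemma and bounds on the Stanley-Wilf limit *)

Section Limits.
Context {R : realType}.

(** The limit is the supremum of the quotients [b n / n], which is why it bounds every term and not
    only asymptotically. *)
Lemma fekete (b : nat -> R) (M : R) :
  (forall n, 0 <= b n) -> (forall m n, b m + b n <= b (m + n)%N) ->
  (forall n, b n <= n%:R * M) ->
  exists V : R, (b n / n%:R @[n --> \oo] --> V) /\ forall n, b n <= n%:R * V.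
Proof.
move=> b0 bD bM.
pose A := [set b n / n%:R | n in [set n | (0 < n)%N]].
have Asup : has_sup A.
  split; first by exists (b 1%N / 1), 1%N.
  exists M => _ [n /= n0 <-]; rewrite ler_pdivrMr ?ltr0n //.
  by rewrite mulrC.
have bV n : b n <= n%:R * sup A.
  have [->|n0] := posnP n; first by have := bM 0%N; rewrite !mul0r.
  rewrite mulrC -ler_pdivrMr ?ltr0n //; apply: ub_le_sup; first by case: Asup.
  by exists n.
have bmul q n : q%:R * b n <= b (q * n)%N.
  elim: q => [|q IH]; first by rewrite mul0r.
  by rewrite mulSn -natr1 mulrDl mul1r addrC; apply: le_trans (bD _ _); rewrite lerD2l.
exists (sup A); split => //.
apply/cvgrPdist_le => e e0.
have e2 : 0 < e / 2 by rewrite divr_gt0.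
have [_ [n n0 <-] nA] := sup_adherent e2 Asup.
rewrite /= in n0.
near=> N.
have N0 : 0 < N%:R :> R by rewrite ltr0n; near: N; exists 1%N.
have NA : b N / N%:R <= sup A by rewrite ler_pdivrMr // mulrC.
rewrite ger0_norm ?subr_ge0 //.
(* Write [N] as a multiple of [n] plus a remainder: superadditivity keeps the multiple, and dropping
   the remainder costs at most one [b n]. *)
have Nb : N%:R * (b n / n%:R) - b n <= b N.
  have r0 : (N %% n < n)%N by rewrite ltn_mod.
  have: (N %/ n)%:R * b n <= b N.
    apply: le_trans (bmul _ _) _; rewrite {2}(divn_eq N n).
    by apply: le_trans (bD _ _); rewrite lerDl.
  apply: le_trans; rewrite lerBlDr mulrA ler_pdivrMr ?ltr0n //.
  have qN : N%:R <= ((N %/ n)%:R + 1) * n%:R :> R.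
    by rewrite natr1 -natrM ler_nat ltnW // ltn_ceil.
  apply: le_trans (ler_wpM2r (b0 n) qN) _.
  by rewrite le_eqVlt; apply/orP; left; apply/eqP; ring.
have Ne : b n / N%:R <= e / 2.
  rewrite ler_pdivrMr // mulrC -ler_pdivrMr //.
  by near: N; apply: nbhs_infty_ger.
have : b n / n%:R - b n / N%:R <= b N / N%:R.
  by rewrite ler_pdivlMr // mulrBl mulfVK ?gt_eqF // mulrC.
move: nA Ne; move: (b n / n%:R) (b n / N%:R) (b N / N%:R) => u v w.
lra.
Unshelve. all: by end_near. Qed.

(** Fekete's lemma for the logarithms of the counts, which are superadditive by [card_Av_super] and
    linearly bounded by [card_Av_exp]. *)
Lemma SW_limit_spec p : (1 < plen p)%N ->
  1 <= SW_limit R p /\ forall n, #|Av n p|%:R <= SW_limit R p ^+ n.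
Proof.
move=> p1; pose a n := #|Av n p|.
have a1 n : 1 <= (a n)%:R :> R by rewrite ler1n card_Av_gt0.
have a0 n : 0 < (a n)%:R :> R by rewrite (lt_le_trans _ (a1 n)).
have [B aB] := card_Av_exp p1.
have B1 : 1 <= B%:R :> R.
  by rewrite ler1n; have := aB 1%N; have := card_Av_gt0 1 p1; rewrite expn1; lia.
have B0 : 0 < B%:R :> R by rewrite (lt_le_trans _ B1).
have [V [bV abV]] : exists V : R, (ln (a n)%:R / n%:R @[n --> \oo] --> V) /\
    forall n, ln (a n)%:R <= n%:R * V.
  apply: (fekete (M := ln B%:R)) => [n|m n|n].
  - exact: ln_ge0.
  - rewrite -lnM ?posrE // ler_ln ?posrE ?mulr_gt0 // -natrM ler_nat.
    exact: card_Av_super.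
  - rewrite mulr_natl -lnXn // ler_ln ?posrE ?exprn_gt0 // -natrX ler_nat.
    exact: aB.
have uV : ((a n)%:R : R) `^ (n%:R^-1) @[n --> \oo] --> expR V.
  have -> : (fun n => ((a n)%:R : R) `^ (n%:R^-1)) = expR \o (fun n => ln (a n)%:R / n%:R).
    by apply/funext => n /=; rewrite /powR gt_eqF // mulrC.
  apply: continuous_cvg => //; exact: continuous_expR.
have -> : SW_limit R p = expR V by apply/cvg_lim.
split.
  rewrite -expR0 ler_expR -[V]mul1r; apply: le_trans (abV 1%N); exact: ln_ge0.
move=> n; have apos : ((a n)%:R : R) \is Num.pos by rewrite posrE.
by rewrite -/(a n) -[leLHS](lnK apos) -expRM_natl ler_expR.
Qed.

(* If the limit did not exist, lim would be the default value 0. *)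
Lemma SW_limit_le p (y : R) : 0 <= y ->
  (forall N, exists2 n, (N < n)%N & #|Av n p|%:R <= y ^+ n) -> SW_limit R p <= y.
Proof.
move=> y0 freq; rewrite /SW_limit; set u := (fun n : nat => _).
have [cvg_u|dvg_u] := pselect (cvg (u @ \oo)); last by rewrite dvgP.
rewrite leNgt; apply/negP => yL.
have /cvgrPdist_lt/(_ (lim (u @ \oo) - y)) := cvg_u.
rewrite subr_gt0 => /(_ yL)[N _ NP].
have [n Nn ny] := freq N.
have := NP n (ltnW Nn); apply/negP; rewrite -leNgt.
have uy : u n <= y.
  rewrite /u; have n0 : (0 < n)%N by apply: leq_ltn_trans Nn.
  apply: le_trans (_ : (y ^+ n) `^ n%:R^-1 <= _).
    by apply: ge0_ler_powR => //; rewrite ?nnegrE ?exprn_ge0 // invr_ge0.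
  rewrite -powR_mulrn // -powRrM mulfV ?pnatr_eq0 -?lt0n // powRr1 //.
rewrite ler_normr; apply/orP; left.
by rewrite lerD2l lerN2.
Qed.

End Limits.
(** * Blockable families *)

Section Blockable.

(** Degree count: [t] has degree 16 in [l], occurs to the power [c + 2], and the result is
    squared. *)
Lemma blocks_constant_le (c K : nat) : exists K' : nat, forall l t : nat, (0 < l)%N ->
  t = (4 * (c * (K * l ^ 8).+1) ^ 2)%N ->
  (16 * (8 * (c * t * t ^ c) * t) ^ 2 <= K' * l ^ (32 * c + 64))%N.
Proof.
pose T := (4 * (c * K.+1) ^ 2)%N.
exists (16 * (8 * c * T ^ c.+2) ^ 2)%N => l t l0 tE.
have tT : (t <= T * l ^ 16)%N.
  rewrite tE /T -mulnA leq_mul2l /= -[16%N]/(8 * 2)%N expnM -expnMn leq_exp2r //.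
  by rewrite -mulnA leq_mul2l mulSn -add1n leq_add2r expn_gt0 l0 orbT.
have -> : (8 * (c * t * t ^ c) * t = 8 * c * t ^ c.+2)%N by rewrite !expnS; lia.
have -> : (l ^ (32 * c + 64) = ((l ^ 16) ^ c.+2) ^ 2)%N.
  by rewrite -!expnM; congr expn; lia.
rewrite -[leqRHS]mulnA -expnMn leq_mul2l leq_exp2r //= -[leqRHS]mulnA -expnMn.
by rewrite leq_mul2l leq_exp2r ?tT ?orbT.
Qed.

Lemma plen_inflation c (s : 'S_c) (P : 'I_c -> pattern) i :
  (plen (P i) <= plen (inflation s P))%N.
Proof. by rewrite /plen /= (bigD1 i) //= leq_addr. Qed.

(** Rounding up gives one integer base that depends only on [k] and [al], hence serves all blocks of
    an inflation at once. *)
Lemma card_Av_le_powR {R : realType} p (al : R) k :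
  0 <= al -> (0 < plen p <= k)%N -> SW_limit R p <= (plen p)%:R `^ al ->
  forall n, (#|Av n p| <= (Num.trunc (k%:R `^ al : R)).+1 ^ n)%N.
Proof.
move=> al0 /andP[p0 pk] Lp n; have [->|n0] := posnP n.
  by rewrite expn0; apply: leq_trans (max_card _) _; rewrite card_Sn.
have [p1|p1] := ltnP 1 (plen p).
  have [L1 LP] := @SW_limit_spec R _ p1.
  rewrite -(ler_nat R) natrX; apply: le_trans (LP n) _.
  apply: lerXn2r; rewrite ?nnegrE ?(le_trans ler01 L1) //.
  apply: le_trans Lp (le_trans _ (ltW (truncnS_gt _))).
  by apply: ge0_ler_powR; rewrite ?nnegrE // ler_nat.
(* Here [p] has length one, so every nonempty permutation contains it. *)
rewrite (_ : #|Av n p| = 0%N) //; apply/eqP; rewrite cards_eq0; apply/eqP/setP => s.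
rewrite !inE; apply/negbTE/negPn/existsP.
exists [ffun=> Ordinal n0]; apply/andP; split.
  apply/forallP => x; apply/forallP => y; apply/implyP.
  by have := ltn_ord x; have := ltn_ord y; lia.
apply/forallP => x; apply/forallP => y; rewrite !ffunE ltnn.
by have := ltn_ord (pperm p x); have := ltn_ord (pperm p y); lia.
Qed.

Lemma SW_limit_blockable {R : realType} c (F : 'I_c -> set pattern) (al : R) :
  (0 < c)%N -> 0 <= al ->
  (forall i P, F i P -> (0 < plen P)%N -> SW_limit R P <= (plen P)%:R `^ al) ->
  exists2 C : R, 0 < C & forall p, blockable_family F p ->
    SW_limit R p <= C * (plen p)%:R `^
      (4 * al + 16 * c%:R ^+ 2 + 64 * al * c%:R ^+ 2 * ln c%:R).
Proof.
move=> c0 al0 F_SW; have [K KP] := ex_le_Av.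
have [K' K'P] := blocks_constant_le c K.
(* The summand 2 covers the case [c = 1] and makes [D] positive. *)
pose D : R := K'%:R * 2 ^+ (32 * c + 64) + 2.
have D0 : 0 < D by rewrite ltr_wpDl // mulr_ge0 // exprn_ge0.
exists D => // _ [s [P [FP ->]]].
set p := inflation s P; set k := plen p; set l := (Num.trunc (k%:R `^ al : R)).+1.
have lP i n : (#|Av n (P i)| <= l ^ n)%N.
  have [FPi Pi0] := FP i.
  by apply: card_Av_le_powR => //; [rewrite Pi0 plen_inflation|apply: F_SW FPi Pi0].
have k1 : 1 <= k%:R :> R.
  rewrite ler1n; apply: leq_trans (plen_inflation s P (Ordinal c0)).
  by have [] := FP (Ordinal c0).
have ka1 : 1 <= k%:R `^ al by rewrite -[leLHS](powRr0 k%:R); apply: ler_powR.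
have l2 : l%:R <= 2 * k%:R `^ al.
  by rewrite /l -natr1 mulr_natl mulr2n lerD // truncn_le powR_ge0.
have lnc : 0 <= ln (c%:R : R) by apply: ln_ge0; rewrite ler1n.
have c1 : 1 <= c%:R :> R by rewrite ler1n.
set e := (X in _ `^ X).
have sub A : bcontains A 1%g s P -> mcontains A p by apply: bcontains_inflation.
have [c2|c2] := leqP 2 c; last first.
  have c_eq1 : c = 1%N by lia.
  (* With a single block the conditions between distinct blocks are vacuous, so a permutation
     avoiding [p] avoids its block. *)
  apply: le_trans (_ : l%:R <= _).
    apply: SW_limit_le => // N; exists N.+1 => //.
    rewrite -natrX ler_nat; apply: leq_trans (lP (Ordinal c0) _).
    apply: subset_leq_card; apply/fintype.subsetP => w; rewrite !inE.
    apply: contra => /contains_graph[r [q rq]]; apply/contains_graph/sub.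
    have ord (i j : 'I_c) : i = j.
      by apply: val_inj => /=; have := ltn_ord i; have := ltn_ord j; lia.
    have wP i : mcontains (graph w) (P i) by rewrite (ord i (Ordinal c0)); exists r, q.
    pose occ i := cid (wP i).
    exists (fun i => projT1 (occ i)), (fun i => projT1 (cid (projT2 (occ i)))).
    split=> [i|i j x y|i j x y]; first exact: (projT2 (cid (projT2 (occ i)))).
      by move=> lt; exfalso; move: lt; rewrite (ord i j) ltnn.
    by move=> lt; exfalso; move: lt; rewrite (ord i j) ltnn.
  apply: le_trans l2 _; apply: ler_pM; rewrite ?powR_ge0 //.
    by rewrite lerDr mulr_ge0 // exprn_ge0.
  apply: ler_powR => //; rewrite /e.
  have : 0 <= al * c%:R ^+ 2 * ln c%:R by rewrite !mulr_ge0 // exprn_ge0.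
  have : 0 <= c%:R ^+ 2 :> R by rewrite exprn_ge0.
  lra.
have exP i : ex_le (K * l ^ 8) (P i) by apply: KP => //; apply: lP.
have := ex_le_blocks c0 exP sub; rewrite /=.
move tE : (4 * _ ^ 2)%N => t; set C := (8 * _ * _)%N => exp.
have t0 : (0 < t)%N by rewrite -tE muln_gt0 expn_gt0 muln_gt0 c0.
have C0 : (0 < C)%N by rewrite /C !muln_gt0 c0 expn_gt0 t0.
apply: le_trans (_ : (16 * C ^ 2)%N%:R <= _).
  (* Bounds along the lengths [2 ^ N * C] suffice. *)
  apply: SW_limit_le => // N; exists (2 ^ N * C)%N.
    by have := ltn_expl N (isT : 1 < 2)%N; nia.
  by rewrite -natrX ler_nat; apply: card_Av_pow.
have := K'P l t (ltn0Sn _) (esym tE); rewrite -/C -(ler_nat R) => /le_trans; apply.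
rewrite natrM natrX; apply: le_trans (_ : K'%:R * (2 * k%:R `^ al) ^+ (32 * c + 64) <= _).
  by apply: ler_wpM2l => //; apply: lerXn2r; rewrite ?nnegrE // mulr_ge0 // powR_ge0.
rewrite exprMn mulrA; apply: ler_pM.
- by rewrite mulr_ge0 // exprn_ge0.
- by rewrite exprn_ge0 // powR_ge0.
- by rewrite lerDl.
rewrite -powR_mulrn ?powR_ge0 // -powRrM; apply: ler_powR => //.
have c2R : 2 <= c%:R :> R by rewrite (ler_nat _ 2).
have cV0 : 0 < c%:R^-1 :> R by rewrite invr_gt0 ltr0n.
(* From [ln (1 + x) <= x] at [x = 1 / c - 1], one gets [ln c >= 1 - 1 / c]. *)
have ln2 : 1 / 2 <= ln (c%:R : R).
  have cV : c%:R^-1 <= 1 / 2 :> R by rewrite div1r lef_pV2 // posrE ltr0n.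
  have := @le_ln1Dx R (c%:R^-1 - 1); rewrite [1 + _]addrC subrK lnV ?posrE ?ltr0n //.
  move: cV cV0; move: (c%:R^-1) (ln _) => x y; lra.
rewrite /e natrD natrM.
(* The logarithmic term is at least [32 * al * c ^ 2], and [c >= 2] makes this at least
   [64 * al * c], hence at least [al * (32 * c + 64)]. *)
have : al * c%:R ^+ 2 * (1 / 2) <= al * c%:R ^+ 2 * ln c%:R.
  by apply: ler_wpM2l => //; rewrite mulr_ge0 // exprn_ge0.
have : al * (2 * c%:R) <= al * c%:R ^+ 2.
  by apply: ler_wpM2l => //; rewrite expr2; apply: ler_wpM2r.
have : al * 2 <= al * c%:R by apply: ler_wpM2l.
have : 0 <= c%:R ^+ 2 :> R by rewrite exprn_ge0.
lra.
Qed.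

End Blockable.

Theorem theorem1p3 (R : realType) (c : nat) (c_gt0 : (0 < c)%N)
    (F : 'I_c -> set pattern) (a : 'I_c -> R)
    (F_SW : forall (i : 'I_c) (P : pattern), F i P ->
      SW_limit R P <= (plen P)%:R `^ a i) :
  let amax : R := \big[Num.max/a (Ordinal c_gt0)]_(i < c) a i in
  (exists2 C : R, 0 < C &
    \forall k \near \oo, forall p : pattern,
      plen p = k -> blockable_family F p ->
      SW_limit R p <=
        C * k%:R `^ (4 * amax + 16 * c%:R ^+ 2
                     + 64 * amax * c%:R ^+ 2 * ln c%:R)) /\
  (exists Q : {poly R}, forall p : pattern,
      blockable_family F p -> SW_limit R p <= Q.[(plen p)%:R]).
Proof.
move=> amax.
have a_le i : a i <= amax by apply: le_bigmax.
have F_le al : amax <= al -> forall i P, F i P -> (0 < plen P)%N ->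
    SW_limit R P <= (plen P)%:R `^ al.
  move=> le_al i P FP P0; apply: le_trans (F_SW i P FP) _.
  by apply: ler_powR; rewrite ?ler1n // (le_trans (a_le i)).
split.
  have [amax0|amax0] := leP 0 amax.
    have [C C0 CP] := SW_limit_blockable c_gt0 amax0 (F_le _ (lexx _)).
    by exists C => //; near=> k => p <-; apply: CP.
  (* For a negative exponent, a block of length above 1 would have limit at least 1 but a bound
     below 1. All blocks are thus points, and no pattern of the family is longer than [c]. *)
  exists 1 => //; near=> k => p pk [s [P [FP pE]]].
  suff : (k <= c)%N.
    by rewrite leqNgt => /negP[]; near: k; exists c.+1.
  rewrite -pk pE /plen /= -[leqRHS]card_ord -sum1_card; apply: leq_sum => i _.
  rewrite leqNgt; apply/negP => P1; have [FPi P0] := FP i.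
  have [L1 _] := @SW_limit_spec R _ P1.
  have := le_trans L1 (F_le _ (lexx _) i _ FPi P0); apply/negP; rewrite -ltNge.
  by rewrite /powR gt_eqF ?ltr0n // expR_lt1 nmulr_rlt0 // ln_gt0 // ltr1n.
(* The polynomial must bound patterns of every length, so a negative exponent is raised to 0. *)
pose al := Num.max amax 0.
have al0 : 0 <= al by rewrite le_max lexx orbT.
have amax_al : amax <= al by rewrite le_max lexx.
have [C C0 CP] := SW_limit_blockable c_gt0 al0 (F_le _ amax_al).
pose e := 4 * al + 16 * c%:R ^+ 2 + 64 * al * c%:R ^+ 2 * ln c%:R.
(* The real exponent is rounded up to a degree, which is harmless since the length is at least 1. *)
exists (C *: 'X^((Num.trunc e).+1)) => p Fp.
apply: le_trans (CP p Fp) _; rewrite hornerZ hornerXn.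
apply: ler_wpM2l; first exact: ltW.
rewrite -[leRHS]powR_mulrn //; apply: ler_powR; last exact/ltW/truncnS_gt.
have [s [P [FP ->]]] := Fp; rewrite ler1n.
by apply: leq_trans (plen_inflation s P (Ordinal c_gt0)); have [] := FP (Ordinal c_gt0).
Unshelve. all: by end_near. Qed.
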